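(* Let $W$, $E$, $Q$, $\Phi_\lambda$, $\lambda_1$, $h(\lambda)$ be as described in the context, and assume that for every $\lambda<\lambda_1$: for any $u\in W\setminus\{0\}$ there exists a unique $t(u)=t(\lambda,u)>0$ such that $t(u)u\in\mathcal{N}_\lambda$, and $\Phi_\lambda(t(u)u)=\max_{t>0}\Phi_\lambda(tu)$. Let $c>0$ and assume that the normalized ground state on $S_c$ is unique and is $u$. Let $\lambda<\lambda_1$ be the Lagrange multiplier of $u$. Then the ground state solution on $\mathcal{N}_\lambda$ is unique.
   Context: $W$ is a real Banach space and $\Phi_\lambda\in C^2(W,\mathbb{R})$, $\lambda\in\mathbb{R}$, has the form $\Phi_\lambda(u)=E(u)-\lambda Q(u)$, where $2Q(u)=D_uQ(u)(u)$ for all $u\in W$; $Q$ plays the role of the $L^2$ mass, with $Q(u)>0$ for $u\ne0$. For $c>0$, $S_c=\{u\in W:Q(u)=c\}$ and $m(c)=\inf_{u\in S_c}E(u)$. A normalized ground state on $S_c$ is a $u\in S_c$ with $E(u)=m(c)$; its Lagrange multiplier is the $\lambda\in\mathbb{R}$ with $D_uE(u)=\lambda D_uQ(u)$. The Nehari manifold is $\mathcal{N}_\lambda=\{u\in W\setminus\{0\}:D_u\Phi_\lambda(u)(u)=0\}$ and $h(\lambda)=\inf_{u\in\mathcal{N}_\lambda}\Phi_\lambda(u)$. For some $\lambda_1\in\mathbb{R}$, it is assumed that $h(\lambda)$ is well-defined and $h(\lambda)\ne0$ for all $\lambda<\lambda_1$. A ground state solution on $\mathcal{N}_\lambda$ is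 a $u\in\mathcal{N}_\lambda$ with $\Phi_\lambda(u)=h(\lambda)$. *)

(* Defs.v *)
From HB Require Import structures.
From mathcomp Require Import all_boot all_order all_algebra.
From mathcomp Require Import all_classical all_reals all_analysis.

Set Implicit Arguments.
Unset Strict Implicit.
Unset Printing Implicit Defensive.

Import Order.TTheory GRing.Theory Num.Theory.
Import numFieldNormedType.Exports.

Local Open Scope classical_set_scope.
Local Open Scope ring_scope.

Section FrechetC2.
Context {R : realType} {W : normedModType R}.

(* B is a bounded bilinear form, i.e. an element of L(W, L(W, R)). *)
Definition bounded_bilinear (B : W -> W -> R) : Prop :=
  [/\ forall w (a : R) v v', B (a *: v + v') w = a * B v w + B v' w,
      forall v (a : R) w w', B v (a *: w + w') = a * B v w + B v w' &
      exists M : R, forall v w, `|B v w| <= M * `|v| * `|w| ].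

(* The library has no normed space of continuous linear maps, so a bound
   ||l|| <= M on an operator norm is written out as |l w| <= M |w| for all w
   (and likewise for L(W, L(W, R))). *)

(* B is the Frechet derivative at u of Df : W -> L(W, R), the latter
   carrying the operator norm. *)
Definition is_second_diff (f : W -> R) (u : W) (B : W -> W -> R) : Prop :=
  bounded_bilinear B /\
  forall e : R, 0 < e -> \forall h \near (0 : W), forall w : W,
    `|'d f (u + h) w - 'd f u w - B h w| <= e * `|h| * `|w|.

Definition C2 (f : W -> R) : Prop :=
  (forall u, differentiable f u) /\
  exists D2f : W -> W -> W -> R,
    (forall u, is_second_diff f u (D2f u)) /\
    (* continuity of D^2 f : W -> L(W, L(W, R)) *)
    (forall u (e : R), 0 < e -> \forall u' \near u, forall v w : W,
      `|D2f u' v w - D2f u v w| <= e * `|v| * `|w|).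

End FrechetC2.

Section GroundStates.
Context {R : realType} {W : normedModType R}.
Variables E Q : W -> R.

Definition Phi (lam : R) (u : W) : R := E u - lam * Q u.

Definition mass_sphere (c : R) : set W := [set u | Q u = c].

Definition min_energy (c : R) : \bar R :=
  ereal_inf [set (E u)%:E | u in mass_sphere c].

Definition normalized_ground_state (c : R) (u : W) : Prop :=
  mass_sphere c u /\ (E u)%:E = min_energy c.

Definition lagrange_multiplier (u : W) (lam : R) : Prop :=
  forall v : W, 'd E u v = lam * 'd Q u v.

Definition nehari (lam : R) : set W :=
  [set u | u <> 0 /\ 'd (Phi lam) u u = 0].

Definition nehari_level (lam : R) : \bar R :=
  ereal_inf [set (Phi lam u)%:E | u in nehari lam].

Definition nehari_ground_state (lam : R) (u : W) : Prop :=
  nehari lam u /\ (Phi lam u)%:E = nehari_level lam.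

End GroundStates.

(* Main.v *)
Require Import Defs.
From HB Require Import structures.
From mathcomp Require Import all_boot all_order all_algebra.
From mathcomp Require Import all_classical all_reals all_analysis.
From mathcomp Require Import ring lra.

Import Order.TTheory GRing.Theory Num.Theory.
Import numFieldNormedType.Exports.

Local Open Scope classical_set_scope.
Local Open Scope ring_scope.

(** The idea is to compare both minimization problems along the rays
    {s v : s > 0}.  The identity 2 Q(v) = dQ(v)(v) is Euler's relation, so Q is
    positively homogeneous of degree 2 ([euler_homogeneous2]); hence every ray
    meets the sphere S_c, on which Phi_lam and E differ by the constant lam c.
    On the other hand, the maximum of Phi_lam on a ray is attained where the ray
    meets the Nehari manifold, so a point v of that manifold maximizes Phi_lam
    on its own ray.  Therefore, if s v is the point of the ray on S_c,
      Phi_lam(v) >= Phi_lam(s v) = E(s v) - lam c >= m(c) - lam c = Phi_lam(u).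
    The multiplier equation puts u itself on the Nehari manifold, so u attains
    h(lam).  If v attains h(lam) too, both inequalities are equalities: s v is
    a normalized ground state, that is s v = u, and since v and s v = u are
    points of the Nehari manifold on the same ray, s = 1 and v = u. *)

Section EulerRelation.
Context {R : realType} {W : normedModType R}.

(** Along t = e^x, Euler's relation says that x |-> Q (e^x v) e^(-2x) has zero
    derivative; the exponential parametrization makes this function
    differentiable on the whole line rather than on a half-line. *)
Lemma euler_homogeneous2 (Q : W -> R) (Qdiff : forall u, differentiable Q u)
    (Qeuler : forall u, 2 * Q u = 'd Q u u) (v : W) (t : R) :
  0 < t -> Q (t *: v) = t ^+ 2 * Q v.
Proof.
pose k (x : R) := Q (expR x *: v) * expR (- x) ^+ 2.
pose q (s : R) := Q (s *: v).
have dq (s : R) : is_derive s (1 : R) q ('d Q (s *: v) v).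
  have lindiff : differentiable ( *:%R ^~ v : R -> W) s by [].
  have qdiff : differentiable q s by apply: differentiable_comp.
  apply: DeriveDef; first exact/derivable1_diffP.
  rewrite deriveE // [LHS](_ : _ =
    ('d Q (s *: v) \o 'd ( *:%R ^~ v : R -> W) s) 1); last by rewrite -diff_comp.
  by rewrite /= diff_val scale1r.
have dk (x : R) : is_derive x 1 k 0.
  have -> : k = (q \o expR) * (expR \o -%R) ^+ 2.
    by apply/funext => y; rewrite !fctE.
  apply: is_derive_eq.
  have dQx : expR x * 'd Q (expR x *: v) v = 2 * Q (expR x *: v).
    by rewrite Qeuler linearZ.
  (* the product rule, before Euler's relation turns it into 0 *)
  change (Q (expR x *: v) * (2 * expR (- x) * (expR (- x) * -1)) +
    expR (- x) ^+ 2 * ('d Q (expR x *: v) v * expR x) = 0).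
  by rewrite [_ * expR x]mulrC dQx; ring.
move=> t_gt0; have := @is_derive_0_is_cst _ k (ln t) 0 dk.
rewrite /k expRN lnK // oppr0 expR0 expr1n mulr1 scale1r => <-.
by field; rewrite gt_eqF.
Qed.

End EulerRelation.

Theorem theoremC4 (R : realType) (W : completeNormedModType R)
    (E Q : W -> R) (lam1 : R)
    (PhiC2 : forall lam : R, C2 (Phi E Q lam))
    (Qhom : forall u : W, 2 * Q u = 'd Q u u)
    (Qpos : forall u : W, u <> 0 -> 0 < Q u)
    (hfin : forall lam : R, lam < lam1 -> nehari_level E Q lam \is a fin_num)
    (hneq0 : forall lam : R, lam < lam1 -> nehari_level E Q lam <> 0%:E)
    (fibering : forall lam : R, lam < lam1 -> forall u : W, u <> 0 ->
      exists2 t : R,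
        unique (fun s : R => 0 < s /\ nehari E Q lam (s *: u)) t &
        forall s : R, 0 < s -> Phi E Q lam (s *: u) <= Phi E Q lam (t *: u))
    (c : R) (c_gt0 : 0 < c) (u : W)
    (u_unique : unique (normalized_ground_state E Q c) u)
    (lam : R) (lam_lt : lam < lam1)
    (u_mult : lagrange_multiplier E Q u lam) :
  exists! v : W, nehari_ground_state E Q lam v.
Proof.
have Phidiff l w : differentiable (Phi E Q l) w by have [+ _] := PhiC2 l.
have Ediff w : differentiable E w.
  suff -> : E = Phi E Q 0 by [].
  by apply/funext => x; rewrite /Phi mul0r subr0.
have Qdiff w : differentiable Q w.
  suff -> : Q = Phi E Q 0 - Phi E Q 1 by apply: differentiableB.
  by apply/funext => x; rewrite /Phi !fctE; ring.
have [[uSc Eu] uniq_u] := u_unique.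
have Qu : Q u = c by [].
have u_neq0 : u <> 0.
  move=> u0; have := Qhom 0; rewrite linear0 -u0 Qu; lra.
have u_nehari : nehari E Q lam u.
  split=> //; rewrite (_ : Phi E Q lam = E - lam *: Q); last first.
    by apply/funext => x; rewrite /Phi !fctE.
  rewrite diffB //; last exact: differentiableZ.
  by rewrite diffZ //= u_mult subrr.
have E_ge w : Q w = c -> E u <= E w.
  by move=> Qw; rewrite -lee_fin Eu; apply: ereal_inf_lbound; exists w.
have PhiE w : Q w = c -> Phi E Q lam w = E w - lam * c.
  by move=> Qw; rewrite /Phi Qw.
have nehari_max v s : nehari E Q lam v -> 0 < s ->
    Phi E Q lam (s *: v) <= Phi E Q lam v.
  move=> vN s_gt0; have [t [_ t_uniq] t_max] := fibering lam lam_lt v vN.1.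
  have t1 : t = 1 by apply: t_uniq; rewrite ltr01 scale1r.
  by move: t_max; rewrite t1 scale1r; apply.
have ray_to_sphere v : v <> 0 -> exists2 s : R, 0 < s & Q (s *: v) = c.
  move=> v_neq0; have Qv := Qpos v v_neq0.
  have s_gt0 : 0 < Num.sqrt (c / Q v) by rewrite sqrtr_gt0 divr_gt0.
  exists (Num.sqrt (c / Q v)) => //.
  rewrite euler_homogeneous2 // sqr_sqrtr ?divr_ge0 ?ltW //.
  by field; rewrite gt_eqF.
have u_min v : nehari E Q lam v -> Phi E Q lam u <= Phi E Q lam v.
  move=> vN; have [s s_gt0 Qs] := ray_to_sphere v vN.1.
  apply: le_trans (nehari_max v s vN s_gt0).
  by rewrite !PhiE // lerD2r E_ge.
have u_level : (Phi E Q lam u)%:E = nehari_level E Q lam.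
  apply/eqP; rewrite eq_le; apply/andP; split.
    by apply: le_ereal_inf_tmp => _ [v vN <-]; rewrite lee_fin u_min.
  by apply: ereal_inf_lbound; exists u.
exists u; split=> // v [vN v_level].
have [s s_gt0 Qs] := ray_to_sphere v vN.1.
have Phi_vu : Phi E Q lam v = Phi E Q lam u.
  by apply: EFin_inj; rewrite v_level u_level.
have u_sv : u = s *: v.
  apply: uniq_u; split=> //; rewrite -Eu; congr EFin.
  apply/eqP; rewrite eq_le E_ge // andbT.
  by rewrite -(lerD2r (- (lam * c))) -!PhiE // -Phi_vu nehari_max.
have [t [_ t_uniq] _] := fibering lam lam_lt v vN.1.
have ts : t = s by apply: t_uniq; rewrite -u_sv.
have t1 : t = 1 by apply: t_uniq; rewrite ltr01 scale1r.
by rewrite u_sv -ts t1 scale1r.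
Qed.
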